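(* Let $\mathfrak g$ be a nilpotent almost abelian Lie algebra admitting a complex structure. Then $\mathfrak g$ admits a pseudo-Kähler structure.
   Context: Lie algebras are real and finite-dimensional. A Lie algebra is almost abelian if it has a codimension-one abelian ideal. A complex structure on a Lie algebra $\mathfrak g$ is $J\in\mathrm{End}(\mathfrak g)$ with $J^2=-\mathrm{Id}$ and $[X,Y]+J[JX,Y]+J[X,JY]-[JX,JY]=0$ for all $X,Y\in\mathfrak g$. A pseudo-Kähler structure is a pair $(J,g)$ with $J$ a complex structure, $g$ a nondegenerate symmetric bilinear form of arbitrary signature with $g(JX,JY)=g(X,Y)$, such that $\omega=g(J\cdot,\cdot)$ satisfies $\omega([X,Y],Z)+\omega([Y,Z],X)+\omega([Z,X],Y)=0$ for all $X,Y,Z\in\mathfrak g$. *)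

(* Defs.v *)
From HB Require Import structures.
From mathcomp Require Import all_boot all_order all_algebra.
From mathcomp Require Import reals.

Set Implicit Arguments.
Unset Strict Implicit.
Unset Printing Implicit Defensive.

Import GRing.Theory.

Local Open Scope ring_scope.

(* vectType provides finite-dimensionality. *)
HB.mixin Record Vector_isLieAlgebra (F : fieldType) L of Vector F L := {
  lie : L -> L -> L;
  lie_linearl_subproof : forall y : L, linear (lie ^~ y);
  lie_linearr_subproof : forall x : L, linear (lie x);
  liexx : forall x : L, lie x x = 0;
  lie_jacobi : forall x y z : L,
    lie x (lie y z) + lie y (lie z x) + lie z (lie x y) = 0
}.

#[short(type="lieAlgType")]
HB.structure Definition LieAlgebra (F : fieldType) :=
  { L of Vector_isLieAlgebra F L & Vector F L }.

Section LieAlgebraTheory.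
Variables (F : fieldType) (L : lieAlgType F).
Implicit Types (x y z : L) (U W I : {vspace L}) (J : 'End(L)).

HB.instance Definition _ :=
  bilinear_isBilinear.Build F L L L *:%R *:%R (@lie F L)
    (@lie_linearl_subproof F L, @lie_linearr_subproof F L).

Definition liev U W : {vspace L} :=
  <<[seq lie x y | x <- vbasis U, y <- vbasis W]>>%VS.

Lemma memv_lie U W x y : x \in U -> y \in W -> lie x y \in liev U W.
Proof.
move=> /coord_vbasis -> /coord_vbasis ->.
rewrite linear_sumlz memv_suml// => i _; rewrite linear_sumr memv_suml// => j _.
rewrite linearZr memvZ// linearZl memvZ// memv_span//.
by apply: allpairs_f; rewrite mem_nth ?size_tuple.
Qed.

Lemma lievP U W (A : {vspace L}) :
  reflect (forall x y, x \in U -> y \in W -> lie x y \in A) (liev U W <= A)%VS.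
Proof.
apply: (iffP idP) => [/subvP sA x y xU yW|hA]; first exact/sA/memv_lie.
apply/span_subvP => _ /allpairsP[[x y] [/= xU yW ->]].
by apply: hA; rewrite vbasis_mem.
Qed.

Fixpoint lower_central n : {vspace L} :=
  if n is m.+1 then liev fullv (lower_central m) else fullv.

Definition lie_nilpotent := exists n, lower_central n = 0%VS.

Definition lie_ideal I := forall x y, y \in I -> lie x y \in I.

Definition lie_abelian_sub U := {in U &, forall x y, lie x y = 0}.

Definition almost_abelian :=
  exists I, [/\ lie_ideal I, lie_abelian_sub I & (\dim I).+1 = \dim {:L}].

Definition complex_structure J :=
  (forall x, J (J x) = - x) /\
  (forall x y, lie x y + J (lie (J x) y) + J (lie x (J y)) - lie (J x) (J y) = 0).

Definition pseudo_kahler J (g : {symmetric L}) :=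
  let omega x y := g (J x) y in
  [/\ complex_structure J,
      nondegenerate g,
      forall x y, g (J x) (J y) = g x y &
      forall x y z,
        omega (lie x y) z + omega (lie y z) x + omega (lie z x) y = 0].

End LieAlgebraTheory.

Arguments lie_nilpotent {F} L.
Arguments almost_abelian {F} L.

(* Main.v *)
Require Import Defs.
From HB Require Import structures.
From mathcomp Require Import all_boot all_order all_algebra.
From mathcomp Require Import reals.

(** The complex structure [J] that is given already carries a pseudo-Kahler
    metric.

    Let [I] be the abelian ideal of codimension one. It is not [J]-stable,
    because [J] would induce a square root of [-1] on the real line [L / I]; so
    there is [e] in [I] with [X = J e] outside [I]. All brackets are determined
    by the nilpotent map [ad X] on [I]. Integrability of [J], applied to [e] and
    an arbitrary vector, says that [ad X] restricted to [I] extends to an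
    endomorphism [A] of [L] that commutes with [J], by [A X = J (ad X e)]. This
    [A] is again nilpotent, and [[x, y] = phi x A y - phi y A x] for the linear
    functional [phi] with kernel [I] and [phi X = 1]
    ([ad_complex_linear_extension]).

    For such a bracket the form [omega] is closed as soon as [A] is
    infinitesimally symplectic for it, which for a [J]-invariant [g] means that
    [B = J A] is [g]-self-adjoint. It remains to find a nondegenerate symmetric
    form that is [J]-invariant and makes the nilpotent complex-linear map [B]
    self-adjoint. In Jordan normal form this is the antidiagonal Hermitian form
    on each block. Here it is built without a basis, by induction on the
    nilpotency index ([nilpotent_self_adjoint_form]): a form [h] for the
    restriction of [B] to its image is pulled back to a form [g] with
    [g (B x) y = h (B x) (B y)], and this partial definition is completed on
    [J]-stable complements ([extend_form]). *)

Set Implicit Arguments.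
Unset Strict Implicit.
Unset Printing Implicit Defensive.

Import Order.TTheory GRing.Theory Num.Theory.
Local Open Scope ring_scope.

(** * Symmetric bilinear forms *)

Section SymmetricOfFunction.
Variables (F : fieldType) (E : vectType F) (f : E -> E -> F).
Hypotheses (fl : forall y, linear_for *%R (f ^~ y)) (fC : forall x y, f x y = f y x).

Let fr x : linear_for *%R (f x).
Proof. by move=> a u v; rewrite !(fC x) fl. Qed.

Let herm x y : f x y = (-1) ^+ false * f y x.
Proof. by rewrite mul1r fC. Qed.

HB.instance Definition _ :=
  bilinear_isBilinear.Build F E E F *%R *%R f (fl, fr).
HB.instance Definition _ :=
  isHermitianSesquilinear.Build F E false idfun f herm.

Lemma symmetric_of_fun : exists g : {symmetric E}, g =2 f.
Proof. by exists (f : {symmetric E}). Qed.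

End SymmetricOfFunction.

Lemma symmC (F : fieldType) (E : vectType F) (g : {symmetric E}) x y :
  g x y = g y x.
Proof. by rewrite {1}(hermitian_subproof (s := g)) mul1r. Qed.

Lemma nondegenerateP (F : fieldType) (E : vectType F) (g : {symmetric E}) :
  (forall x, (forall y, g x y = 0) -> x = 0) <-> nondegenerate g.
Proof.
split=> [g0|].
  rewrite /nondegenerate -subv0; apply/subvP => x /mem_orthovP gx.
  by rewrite memv0; apply/eqP/g0 => y; apply: gx; rewrite memvf.
move=> /eqP g0 x gx; apply/eqP; rewrite -memv0 -g0.
by apply/mem_orthovP => y _; apply: gx.
Qed.

(** * Linear algebra over a complex structure *)

Section ComplexVectorSpaces.
Variables (R : realFieldType) (E : vectType R) (J : 'End(E)).
Hypothesis J2 : forall x, J (J x) = - x.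

(** Maschke's argument for the group of order four generated by [J]: any
    projection [q] onto [U] along [V] averages to [(q - J q J) / 2]. *)
Lemma stable_projection (U V : {vspace E}) :
  (forall x, x \in U -> J x \in U) -> (forall x, x \in V -> J x \in V) ->
  (U :&: V = 0)%VS ->
  exists p : 'End(E), [/\ forall x, p (J x) = J (p x), forall x, p x \in U,
    forall x, x \in U -> p x = x & forall x, x \in V -> p x = 0].
Proof.
move=> JU JV dUV; pose q := daddv_pi U V.
have qU x : q x \in U by exact: memv_pi.
have qid x : x \in U -> q x = x by exact: daddv_pi_id.
have q0 x : x \in V -> q x = 0.
  move=> xV; have /= := daddv_pi_add dUV (subvP (addvSr U V) _ xV).
  by rewrite (daddv_pi_id _ xV) 1?capvC// -[RHS]add0r => /addIr.
pose p : 'End(E) := 2%:R^-1 *: (q - (J \o (q \o J))%VF).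
have pE x : p x = 2%:R^-1 *: (q x - J (q (J x))).
  by rewrite scale_lfunE add_lfunE opp_lfunE !comp_lfunE.
exists p; split=> x.
- by rewrite !pE linearZ/= [J (_ - _)]linearB/= !J2 linearN/= linearN/= !opprK addrC.
- by rewrite pE memvZ// memvB// JU.
- move=> xU; rewrite pE (qid x xU) (qid _ (JU x xU)) J2 opprK.
  by rewrite -mulr2n -scaler_nat scalerA mulVf ?scale1r// pnatr_eq0.
- by move=> xV; rewrite pE q0// (q0 _ (JV x xV)) linear0 subr0 scaler0.
Qed.

Lemma stable_complement (U K : {vspace E}) :
  (forall x, x \in U -> J x \in U) -> (forall x, x \in K -> J x \in K) ->
  exists C : {vspace E}, [/\ forall x, x \in C -> J x \in C, (C <= K)%VS,
    (U :&: C = 0)%VS & (K <= U + C)%VS].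
Proof.
move=> JU JK.
have JUK x : x \in (U :&: K)%VS -> J x \in (U :&: K)%VS.
  by move=> /memv_capP[xU xK]; rewrite memv_cap JU// JK.
have J0 x : x \in (0%VS : {vspace E}) -> J x \in (0%VS : {vspace E}).
  by rewrite !memv0 => /eqP->; rewrite linear0.
have [p [pJ pUK pid _]] := stable_projection JUK J0 (capv0 _).
exists (lker p :&: K)%VS; split.
- move=> x /memv_capP[]; rewrite memv_ker => /eqP px xK.
  by rewrite memv_cap memv_ker pJ px linear0 eqxx JK.
- exact: capvSr.
- apply/eqP; rewrite -subv0; apply/subvP => x /memv_capP[xU].
  move=> /memv_capP[]; rewrite memv_ker => /eqP px xK.
  by rewrite memv0 -px pid// memv_cap xU.
- apply/subvP => x xK; rewrite -[x](subrKC (p x)).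
  have /memv_capP[pU pK] := pUK x.
  apply: memv_add => //; rewrite memv_cap (memvB xK pK) andbT memv_ker linearB/=.
  by rewrite (pid (p x)) ?subrr.
Qed.

(** Averaging the standard inner product [d] of a basis over [J]. *)
Lemma invariant_inner_product : exists s : {symmetric E},
  (forall x y, s (J x) (J y) = s x y) /\ (forall x, s x x = 0 -> x = 0).
Proof.
pose c i x := coord (vbasis {:E}) i x.
pose d x y := \sum_i c i x * c i y.
have dl y : linear_for *%R (d ^~ y).
  move=> a u v; rewrite /d mulr_sumr -big_split/=; apply: eq_bigr => i _.
  by rewrite /c linearP/= mulrDl mulrA.
have dN x y : d (- x) (- y) = d x y.
  by apply: eq_bigr => i _; rewrite /c !linearN/= mulrNN.
have d_ge0 x : 0 <= d x x by apply: sumr_ge0 => i _; rewrite -expr2 sqr_ge0.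
have d_eq0 x : d x x = 0 -> x = 0.
  move=> /eqP; rewrite psumr_eq0; last by move=> i _; rewrite -expr2 sqr_ge0.
  move=> /allP c0; rewrite (coord_vbasis (memvf x)) big1// => i _.
  have := c0 i (mem_index_enum i); rewrite mulf_eq0 orbb => /eqP.
  by rewrite /c => ->; rewrite scale0r.
have [||s sE] := @symmetric_of_fun R E (fun x y => d x y + d (J x) (J y)).
- by move=> y a u v; rewrite /= linearP/= !dl mulrDr addrACA.
- by move=> x y; congr (_ + _); apply: eq_bigr => i _; rewrite mulrC.
exists s; split=> [x y|x].
  by rewrite !sE !J2 dN addrC.
by rewrite sE => /eqP; rewrite paddr_eq0// => /andP[/eqP/d_eq0].
Qed.

End ComplexVectorSpaces.

(** * Invariant forms making a nilpotent map self-adjoint *)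

(** An endomorphism [B] of [E] is given by its factorisation [B = i b] through
    its image [F]; then [b i] is the restriction of [B] to its image. The map
    [p] is a projection onto [F], and [r] a projection onto a complement of
    [im B] in [im B + ker B], contained in [ker B] and in [ker p]. All maps
    commute with the complex structures [J] and [J'] of [E] and [F]. *)
Section Extension.
Variables (R : realFieldType) (E F : vectType R).
Variables (J : 'End(E)) (J' : 'End(F)).
Variables (b p : {linear E -> F}) (i : {linear F -> E}) (r : 'End(E)).
Hypotheses (J2 : forall x, J (J x) = - x).
Hypotheses (bJ : forall x, b (J x) = J' (b x)) (iJ : forall w, i (J' w) = J (i w))
  (pJ : forall x, p (J x) = J' (p x)) (rJ : forall x, r (J x) = J (r x)).
Hypotheses (b_surj : forall w, exists x, w = b x) (iK : cancel i p)
  (ri : forall w, r (i w) = 0) (br : forall x, b (r x) = 0)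
  (pr : forall x, p (r x) = 0) (rr : forall x, r (r x) = r x)
  (ker_br : forall x, b x = 0 -> r x = 0 -> x = i (p x)).
Variable h : {symmetric F}.
Hypotheses (hJ : forall u v, h (J' u) (J' v) = h u v)
  (hB : forall u v, h (b (i u)) v = h u (b (i v)))
  (h0 : forall u, (forall v, h u v = 0) -> u = 0).

(** The three terms in [h] are the only choice for which
    [g (B x) y = h (b x) (b y)] and the complement [ker p] of the image is
    isotropic; this identity gives self-adjointness.
    A vector in the radical is then killed by [b], hence lies in [ker B]. On
    [ker B] the form still misses a complement of [im B] inside
    [im B + ker B], which corresponds to the Jordan blocks of size one and is
    the image of [r]; the positive definite summand [s (r x) (r y)] repairs
    exactly this. *)
Lemma extend_form : exists g : {symmetric E},
  [/\ forall x y, g (J x) (J y) = g x y,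
      forall x y, g (i (b x)) y = g x (i (b y)) &
      forall x, (forall y, g x y = 0) -> x = 0].
Proof.
have [s [sJ s0]] := invariant_inner_product J2.
have [||g gE] := @symmetric_of_fun R E (fun x y =>
  h (p x) (b y) + h (b x) (p y) - h (p x) (b (i (p y))) + s (r x) (r y)).
- move=> y a u v /=; rewrite !linearP/= !linearPl/=.
  rewrite !mulrDr mulrN opprD.
  rewrite (addrACA (a * h (p u) (b y))) (addrACA (a * h (p u) (b y) + _)).
  by rewrite (addrACA (a * h (p u) (b y) + _ + _)).
- move=> x y /=; congr (_ + _).
    rewrite -hB [h (b (i _)) _]symmC [h (p x) (b y)]symmC.
    by rewrite [h (b x) (p y)]symmC [X in X - _]addrC.
  exact: symmC.
have gB x y : g x (i (b y)) = h (b x) (b y).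
  rewrite gE !iK ri linear0r addr0 addrAC -hB addrAC.
  rewrite [h (b (i _)) _]hB.
  by rewrite addrAC subrr add0r.
exists g; split=> [x y|x y|x gx].
- by rewrite !gE !rJ !bJ !pJ iJ bJ !hJ sJ.
- by rewrite [LHS]symmC !gB symmC.
- have bx : b x = 0.
    by apply: h0 => v; have [z ->] := b_surj v; rewrite -gB.
  (* pairing with [r x] isolates the positive definite summand *)
  have rx : r x = 0.
    apply: s0; have := gx (r x).
    by rewrite gE br pr bx !linear0 rr subr0 !add0r. 
  have xE := ker_br bx rx.
  suff px : p x = 0 by rewrite xE px linear0.
  apply: h0 => v; have [z ->] := b_surj v.
  have := gx z; rewrite gE bx rx -hB -xE bx.
  by rewrite !linear0l subr0 !addr0.
Qed.

End Extension.

(** Induction on the nilpotency index, which drops by one on the image of [B]. *)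
Theorem nilpotent_self_adjoint_form (R : realFieldType) (k : nat) (E : vectType R)
    (J B : 'End(E)) :
  (forall x, J (J x) = - x) -> (forall x, B (J x) = J (B x)) ->
  (forall x, iter k B x = 0) ->
  exists g : {symmetric E}, [/\ forall x y, g (J x) (J y) = g x y,
      forall x y, g (B x) y = g x (B y) &
      forall x, (forall y, g x y = 0) -> x = 0].
Proof.
elim: k E J B => [|k IH] E J B J2 BJ Bk.
  have [g gE] := @symmetric_of_fun R E (fun _ _ => 0)
    (fun _ a _ _ => esym (etrans (addr0 _) (mulr0 a))) (fun _ _ => erefl).
  by exists g; split=> [x y|x y|x _]; [rewrite !gE|rewrite !gE|exact: (Bk x)].
pose U := limg B; pose F := subvs_of U.
have JU x : x \in U -> J x \in U.
  by move=> /memv_imgP[u _ ->]; rewrite -BJ memv_img// memvf.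
have BU x : B x \in U by rewrite memv_img// memvf.
have JK x : x \in lker B -> J x \in lker B.
  by rewrite !memv_ker BJ => /eqP->; rewrite linear0.
have [C [JC CK dUC KUC]] := stable_complement J2 JU JK.
have [p [pJ pU pid pC]] := stable_projection J2 JU JC dUC.
have [|r [rJ rC rid rU]] := stable_projection J2 JC JU _; first by rewrite capvC.
pose i : {linear F -> E} := (vsval : {linear subvs_of U -> E}).
pose b : {linear E -> F} := vsproj U \o B.
pose p' : {linear E -> F} := vsproj U \o p.
pose J' : 'End(F) := linfun (vsproj U \o J \o i).
pose B' : 'End(F) := linfun (b \o i).
have iJ w : i (J' w) = J (i w).
  by rewrite lfunE/= vsprojK// JU// subvsP.
have ib x : i (b x) = B x by rewrite /= vsprojK.
have ip x : i (p' x) = p x by rewrite /= vsprojK.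
have i_inj : injective i by exact: val_inj.
have iB w : i (B' w) = B (i w) by rewrite lfunE ib.
have b_surj w : exists x, w = b x.
  have /memv_imgP[x _ wx] : i w \in U by exact: subvsP.
  by exists x; apply: i_inj; rewrite ib.
have B'k w : iter k B' w = 0.
  have [x ->] := b_surj w; apply: i_inj; rewrite linear0 -[RHS](Bk x).
  by rewrite iterSr -ib; elim: k {IH Bk} => //= k IHk; rewrite -IHk iB.
have [|w|h [hJ hB h0]] := IH F J' B' _ _ B'k.
- by move=> w; apply: i_inj; rewrite !iJ J2 linearN.
- by apply: i_inj; rewrite iB !iJ iB BJ.
have [] := @extend_form R E F J J' b p' i r J2 _ iJ _ _ b_surj _ _ _ _ _ _ h hJ _ h0.
- by move=> x; apply: i_inj; rewrite iJ !ib BJ.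
- by move=> x; apply: i_inj; rewrite iJ !ip pJ.
- exact: rJ.
- by move=> w; apply: i_inj; rewrite ip pid// subvsP.
- by move=> w; rewrite rU// subvsP.
- move=> x; apply: i_inj; rewrite ib linear0; apply/eqP.
  by rewrite -memv_ker (subvP CK).
- by move=> x; apply: i_inj; rewrite ip linear0 pC.
- by move=> x; rewrite rid.
- move=> x bx rx; rewrite ip.
  have : x \in lker B by rewrite memv_ker -ib bx linear0.
  move=> /(subvP KUC)/memv_addP[u uU [c cC xE]].
  move: rx; rewrite xE !linearD/= rU// rid// add0r => c0.
  by rewrite c0 linear0 !addr0 pid.
- by move=> u v; have := hB u v; rewrite !lfunE.
move=> g [gJ gB g0]; exists g; split=> // x y.
by rewrite -!ib.
Qed.

(** * Almost abelian Lie algebras with a complex structure *)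

Lemma hyperplane_functional (F : fieldType) (E : vectType F) (I : {vspace E}) X :
  (\dim I).+1 = \dim {:E} -> X \notin I ->
  exists phi : {linear E -> F^o},
    [/\ forall y, y - phi y *: X \in I, phi X = 1 & forall y, y \in I -> phi y = 0].
Proof.
move=> dimI XI.
have X0 : X != 0 by apply: contraNneq XI => ->; rewrite mem0v.
have IXmul a : a *: X \in I -> a = 0.
  by rewrite rpredZeq (negPf XI) orbF => /eqP.
have dXI : (<[X]> :&: I = 0)%VS.
  apply/eqP; rewrite -subv0; apply/subvP => _ /memv_capP[/vlineP[a ->] /IXmul ->].
  by rewrite scale0r mem0v.
have XI_full : (<[X]> + I = fullv)%VS.
  apply/eqP; rewrite eqEdim subvf/= dimv_disjoint_sum// dim_vline X0 add1n.
  by rewrite dimI.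
pose phi : {linear E -> F^o} := coord [tuple X] ord0 \o daddv_pi <[X]> I.
have phiP y : y - phi y *: X \in I.
  have -> : phi y *: X = daddv_pi <[X]> I y.
    have : daddv_pi <[X]> I y \in <<[tuple X]>>%VS by rewrite span_seq1 memv_pi.
    by move=> /coord_span yE; rewrite [RHS]yE big_ord1.
  have := daddv_pi_add dXI (w := y); rewrite XI_full memvf => /(_ isT) {1}<-.
  by rewrite addrC addKr memv_pi.
exists phi; split=> // [|y yI].
  have := phiP X; rewrite -{1}[X]scale1r -scalerBl => /IXmul/eqP.
  by rewrite subr_eq0 => /eqP.
by apply: IXmul; rewrite -[_ *: X](subKr y) memvB.
Qed.

(** If [I] were [J]-stable and [J X = c X] modulo [I], then applying [J] once
    more would give [- X = c ^ 2 X] modulo [I], so [c ^ 2 = -1]. *)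
Lemma hyperplane_not_stable (R : realFieldType) (E : vectType R) (J : 'End(E))
    (I : {vspace E}) :
  (forall x, J (J x) = - x) -> (\dim I).+1 = \dim {:E} ->
  exists2 e, e \in I & J e \notin I.
Proof.
move=> J2 dimI.
case: (boolP (J @: I <= I)%VS) => [/subvP JI|/subvPn[_ /memv_imgP[e eI ->] JeI]];
  last by exists e.
have /subvPn[X _ XI] : ~~ ({:E} <= I)%VS.
  by apply/negP => /dimvS; rewrite -dimI ltnn.
have [phi [phiP phiX phi0]] := hyperplane_functional dimI XI.
set c := phi (J X); have := phiP (J X); rewrite -/c => cI.
have := phi0 _ (JI _ (memv_img J cI)).
rewrite linearB linearZ/= J2 linearB linearN linearZ/= phiX -/c => /eqP.
rewrite -opprD oppr_eq0 gt_eqF//.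
exact: ltr_wpDr (sqr_ge0 c) ltr01.
Qed.

Lemma lieC (F : fieldType) (L : lieAlgType F) (x y : L) : lie x y = - lie y x.
Proof.
have := liexx (x + y); rewrite linearDl !linearDr /= !liexx add0r addr0.
by move=> /eqP; rewrite addr_eq0 => /eqP.
Qed.

Lemma lower_central_iter (F : fieldType) (L : lieAlgType F) (x y : L) k :
  iter k (lie x) y \in lower_central L k.
Proof.
by elim: k => [|k IH]/=; [exact: memvf|exact: memv_lie (memvf _) IH].
Qed.

Section AlmostAbelian.
Variables (R : realFieldType) (L : lieAlgType R) (I : {vspace L}) (J : 'End(L)).
Hypotheses (idI : lie_ideal I) (abI : lie_abelian_sub I)
  (dimI : (\dim I).+1 = \dim {:L}).
Hypothesis (JC : complex_structure J).

(** With [X = J e] as in [hyperplane_not_stable], [A] is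
    [ad X + phi J (ad X e)]. It agrees with [ad X] on [I], where [ad X] is
    nilpotent; and since [e] is in [I], [A ^ k e = 0] forces
    [A ^ k X = J (A ^ k e) = 0]. In the bracket formula the correction term
    [phi J (ad X e)] cancels by antisymmetry. *)
Lemma ad_complex_linear_extension : lie_nilpotent L ->
  exists (A : 'End(L)) (phi : {linear L -> R^o}) k,
  [/\ forall x, A (J x) = J (A x), forall x, iter k A x = 0 &
      forall x y, lie x y = phi x *: A y - phi y *: A x].
Proof.
move=> [k Lk]; have [J2 Jint] := JC.
have [e eI XI] := hyperplane_not_stable J2 dimI; set X := J e in XI.
have [phi [phiP phiX phi0]] := hyperplane_functional dimI XI.
pose f x := lie X x + phi x *: J (lie X e).
have f_lin : linear f.
  move=> a u v; rewrite /f linearPr linearP/= scalerDr scalerDl scalerA.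
  by rewrite addrACA.
pose fL : {linear L -> L} := HB.pack f (GRing.isLinear.Build R L L *:%R f f_lin).
pose A : 'End(L) := linfun fL.
have AE x : A x = lie X x + phi x *: J (lie X e) by rewrite lfunE.
(* [e] commutes with [I], so only the component of [y] along [X] matters *)
have lie_e y : lie e y = - (phi y *: lie X e).
  rewrite -{1}[y](subrK (phi y *: X)) linearDr/= abI// add0r linearZr/=.
  by rewrite [lie e X]lieC scalerN.
(* the difference [J (A x) - A (J x)] is the integrability expression at [e], [x] *)
have AJ x : A (J x) = J (A x).
  have := Jint e x; rewrite -/X !lie_e !AE.
  rewrite [J (_ + _)]linearD/= [J (_ *: J _)]linearZ/= J2.
  rewrite [J (- _)]linearN/= [J (_ *: _)]linearZ/=.
  move=> eq0; apply/eqP; rewrite eq_sym -subr_eq0 -[X in _ == X]eq0; apply/eqP.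
  by rewrite scalerN opprD addrA [J _ - _]addrC [LHS]addrAC.
have AI x : x \in I -> A x = lie X x.
  by move=> xI; rewrite AE phi0// scale0r addr0.
have iterAI m x : x \in I -> iter m A x = iter m (lie X) x /\ iter m A x \in I.
  move=> xI; elim: m => //= m [IH mI]; rewrite -IH AI//; split=> //.
  exact: idI.
have iterA0 x : x \in I -> iter k A x = 0.
  move=> /(iterAI k)[-> _]; apply/eqP; rewrite -memv0 -Lk.
  exact: lower_central_iter.
have iterAX : iter k A X = 0.
  rewrite -[RHS](linear0 J) -(iterA0 e eI).
  by elim: k {Lk iterA0} => //= m ->; rewrite AJ.
have iterAD m u v a : iter m A (u + a *: v) = iter m A u + a *: iter m A v.
  by elim: m => //= m ->; rewrite linearD linearZ.
exists A, phi, k; split=> // [x|x y].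
  by rewrite -[x](subrK (phi x *: X)) iterAD iterA0// iterAX scaler0 addr0.
rewrite -{1}[x](subrK (phi x *: X)) -{1}[y](subrK (phi y *: X)).
rewrite [LHS]linearDl [in LHS]linearDr/= abI// add0r subrK.
rewrite [lie _ (phi y *: X)]linearZr/= [lie _ X]lieC linearBr linearZr/= liexx.
rewrite scaler0 subr0 [lie (phi x *: X) y]linearZl/= !AE.
rewrite scalerN !scalerDr opprD !scalerA [phi y * phi x]mulrC.
by rewrite addrACA subrr addr0 addrC.
Qed.

End AlmostAbelian.

Theorem corollary4p5 (R : realType) (L : lieAlgType R) :
  lie_nilpotent L -> almost_abelian L ->
  (exists J : 'End(L), complex_structure J) ->
  exists (J : 'End(L)) (g : {symmetric L}%R), pseudo_kahler J g.
Proof.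
move=> nilL [I [idI abI dimI]] [J JC]; have [J2 _] := JC.
have [A [phi [k [AJ Ak lieE]]]] := ad_complex_linear_extension idI abI dimI JC nilL.
have JAk x : iter k (J \o A)%VF x = 0.
  have AJm m z : A (iter m J z) = iter m J (A z).
    by elim: m => //= m IH; rewrite AJ IH.
  have -> : iter k (J \o A)%VF x = iter k J (iter k A x).
    by elim: k {Ak} => //= k ->; rewrite comp_lfunE AJm.
  by rewrite Ak; elim: k {Ak} => //= k ->; rewrite linear0.
have [|g [gJ gJA g0]] := nilpotent_self_adjoint_form J2 _ JAk.
  by move=> x; rewrite !comp_lfunE AJ.
(* [omega (A x) y] is symmetric: [A] is infinitesimally symplectic *)
have gAC x y : g (J (A x)) y = g (J (A y)) x.
  by have := gJA x y; rewrite !comp_lfunE [RHS]symmC.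
exists J, g; split=> // [|x y z]; first exact/nondegenerateP.
have omegaB a b u v w :
    g (J (a *: u - b *: v)) w = a * g (J u) w - b * g (J v) w.
  by rewrite [J _]linearB/= ![J (_ *: _)]linearZ/= linearBl !linearZl.
rewrite !lieE !omegaB [g (J (A y)) x]gAC [g (J (A z)) x]gAC [g (J (A z)) y]gAC.
by rewrite !subrKA subrr.
Qed.
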